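(* For any natural number $n\geq 1$ there exist a non-discrete abelian topological group $G$ and a homogeneous binary $G$-space $X$, with $X$ a non-discrete topological space, such that $X$ has the stabilization property at the $n$-th step at some point $x\in X$.
   Context: A binary action of a topological group $G$ on a topological space $X$ is a continuous map $\mu : G\times X\times X\to X$, written $\mu(g,x,y)=g(x,y)$, such that $gh(x,y)=g(x,h(x,y))$ and $e(x,y)=y$ for all $g,h\in G$, $x,y\in X$, where $e$ is the identity of $G$. The triple $(G,X,\mu)$ (or just $X$) is then called a binary $G$-space. For $A\subset X$ put $G(A,A)=\{g(a_1,a_2): g\in G,\ a_1,a_2\in A\}$, and for $x\in X$ put $G(x,x)=\{g(x,x): g\in G\}$. A subset $A\subset X$ is bi-invariant if $G(A,A)=A$. The orbit $[x]$ of $x\in X$ is the minimal bi-invariant subset of $X$ containing $x$. A binary $G$-space $X$ is homogeneous if there is a point $x\in X$ with $[x]=X$. For $x\in X$ define $G^1(x)=G(x,x)$ and $G^{n}(x)=G(G^{n-1}(x),G^{n-1}(x))$ for $n\geq 2$. A homogeneous binary $G$-space $X$ has the stabilization property at the $n$-th step at the point $x$ if $G^n(x)=X$ but $G^{n-1}(x)\neq X$; for $n=1$ the condition is $G^1(x)=X$. *)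

(* Defs.v *)
From HB Require Import structures.
From mathcomp Require Import all_boot all_order all_algebra.
From mathcomp Require Import all_classical all_reals all_analysis.

Set Implicit Arguments.
Unset Strict Implicit.
Unset Printing Implicit Defensive.

Import GRing.Theory.

Local Open Scope classical_set_scope.
Local Open Scope ring_scope.

(* The condition is the axiom of the library's [discreteTopologicalType]; being
   a mixin there, it is repeated as a predicate so that it can be negated. *)
Definition discrete_space (T : topologicalType) : Prop :=
  @nbhs T T = @principal_filter T.

Lemma discrete_spaceP (T : topologicalType) :
  discrete_space T <-> forall A : set T, open A.
Proof.
split=> [dT A|oT].
  rewrite openE => x Ax; rewrite /interior dT.
  exact/principal_filterP.
apply/funext => x; apply/seteqP; split => A.
  by move=> /nbhs_singleton Ax; exact/principal_filterP.
by move=> /principal_filterP Ax; apply: open_nbhs_nbhs; split.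
Qed.

(* The abelian group [G] is written additively: the product [gh] is [g + h] and
   the identity [e] is [0]. *)
Record binary_action (G : topologicalZmodType) (X : topologicalType)
    (mu : G -> X -> X -> X) : Prop := BinaryAction {
  binary_action_continuous :
    continuous (fun p : G * X * X => mu p.1.1 p.1.2 p.2) ;
  binary_actionD : forall g h x y, mu (g + h) x y = mu g x (mu h x y) ;
  binary_action0 : forall x y, mu 0 x y = y
}.

Definition act_set (G X : Type) (mu : G -> X -> X -> X) (A : set X) : set X :=
  [set y | exists g a1 a2, [/\ A a1, A a2 & y = mu g a1 a2]].

Definition act_pt (G X : Type) (mu : G -> X -> X -> X) (x : X) : set X :=
  [set mu g x x | g in [set: G]].

Definition bi_invariant (G X : Type) (mu : G -> X -> X -> X) (A : set X) :
  Prop := act_set mu A = A.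

(* [smallest] is the intersection of all bi-invariant sets containing [x]; it is
   itself bi-invariant by [bi_orbit_bi_invariant], hence the minimal one. *)
Definition bi_orbit (G X : Type) (mu : G -> X -> X -> X) (x : X) : set X :=
  smallest (bi_invariant mu) [set x].

Definition homogeneous (G X : Type) (mu : G -> X -> X -> X) : Prop :=
  exists x : X, bi_orbit mu x = [set: X].

(* Only meaningful for [1 <= n]; the value at [n = 0] is never used. *)
Definition act_iter (G X : Type) (mu : G -> X -> X -> X) (n : nat) (x : X) :
  set X := iter n.-1 (act_set mu) (act_pt mu x).

Definition stabilizes_at (G X : Type) (mu : G -> X -> X -> X) (n : nat)
    (x : X) : Prop :=
  act_iter mu n x = [set: X] /\
  ((1 < n)%N -> act_iter mu n.-1 x <> [set: X]).

Lemma bi_orbit_bi_invariant (G : topologicalZmodType) (X : topologicalType)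
    (mu : G -> X -> X -> X) (x : X) :
  binary_action mu -> bi_invariant mu (bi_orbit mu x).
Proof.
move=> muP; apply/seteqP; split => [_ [g [a [b [oa ob ->]]]]|y oy]; last first.
  by exists 0, y, y; split => //; rewrite (binary_action0 muP).
move=> A [/= iA xA]; rewrite -iA; exists g, a, b.
by split => //; [exact: oa|exact: ob].
Qed.

Lemma act_iter1 (G X : Type) (mu : G -> X -> X -> X) (x : X) :
  act_iter mu 1 x = act_pt mu x.
Proof. by []. Qed.

Lemma act_iterSS (G X : Type) (mu : G -> X -> X -> X) (n : nat) (x : X) :
  act_iter mu n.+2 x = act_set mu (act_iter mu n.+1 x).
Proof. by []. Qed.

(* Main.v *)
Require Import Defs.
From HB Require Import structures.
From mathcomp Require Import all_boot all_order all_algebra.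
From mathcomp Require Import all_classical all_reals all_analysis.
From mathcomp Require Import Rstruct.

(** The real line acts on the space of real row vectors of length n by
      g(x, y) = y + g v(x),   v(x) = (1, x_0, x_1, ..., x_(n-2)):
    the first point x selects a direction v(x), and the group translates the
    second point y along it.  For each fixed x this is an action by
    translations, and only the continuity of v is needed for the whole map to
    be continuous.

    The direction field v is a shift, so it climbs the standard flag
    F_0 = 0 < F_1 < ... < F_n, where F_k consists of the vectors supported on
    the first k coordinates, one step at a time.  It maps F_k into F_(k+1), hence
    G(F_k, F_k) lies in F_(k+1).  Conversely F_k contains a point b with
    v(b)_k = 1, namely the basis vector e_(k-1), or 0 if k = 0; so the lines of
    direction v(b) through the points of F_k fill F_(k+1).  Therefore
    G(F_k, F_k) = F_(k+1) (lemma act_set_flag), and iterating from the origin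
    gives G^k(0) = F_k for all k <= n: the whole space is reached at step n and
    not before.  It is homogeneous because the orbit of 0 contains every
    G^k(0). *)

Set Implicit Arguments.
Unset Strict Implicit.
Unset Printing Implicit Defensive.

Import GRing.Theory numFieldNormedType.Exports.

Local Open Scope classical_set_scope.
Local Open Scope ring_scope.

Section BinaryOrbits.
Variables (G X : Type) (mu : G -> X -> X -> X).

Lemma act_set1 (x : X) : act_set mu [set x] = act_pt mu x.
Proof.
apply/seteqP; split => [_ [g [_ [_ [-> -> ->]]]]|_ [g _ <-]]; first by exists g.
by exists g, x, x.
Qed.

Lemma act_iterE (k : nat) (x : X) : (0 < k)%N ->
  act_iter mu k x = iter k (act_set mu) [set x].
Proof. by case: k => // k _; rewrite /act_iter iterSr act_set1. Qed.

Lemma act_iter_sub_orbit (k : nat) (x : X) :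
  iter k (act_set mu) [set x] `<=` bi_orbit mu x.
Proof.
move=> y ky A [/= iA xA]; elim: k y ky => [|k IHk] y /=; first exact: xA.
by move=> [g [a [b [/IHk Aa /IHk Ab ->]]]]; rewrite -iA; exists g, a, b.
Qed.

End BinaryOrbits.

Section NonDiscrete.

(** Discreteness pulls back along continuous injections, so a space containing
    a continuous injective image of a line is not discrete. *)
Lemma discrete_inj (S T : topologicalType) (f : S -> T) :
  injective f -> continuous f -> discrete_space T -> discrete_space S.
Proof.
move=> finj fcont /discrete_spaceP oT; apply/discrete_spaceP => A.
rewrite -(_ : f @^-1` (f @` A) = A).
  by apply: open_comp (oT _) => x _; exact: fcont.
by apply/seteqP; split => x => [[y Ay /finj <-]|Ax] //; exists x.
Qed.

Lemma numField_not_discrete (K : numFieldType) : ~ discrete_space K^o.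
Proof.
move=> dK; have : (0 : K^o)^' set0.
  rewrite /dnbhs /within /= dK; apply/principal_filterP => /=.
  by rewrite eqxx.
exact: filter_not_empty.
Qed.

Lemma continuous_mx (S T : topologicalType) (m n : nat) (f : S -> 'M[T]_(m, n)) :
  (forall i j, continuous (fun x => f x i j)) -> continuous f.
Proof.
move=> fcont x A [P xP PA]; rewrite /nbhs /=.
have : \forall y \near x, forall ij : 'I_m * 'I_n, P ij.1 ij.2 (f y ij.1 ij.2).
  by apply: filter_forall => -[i j]; apply: fcont; exact: xP.
by apply: filterS => y Py; apply: PA => i j; exact: (Py (i, j)).
Qed.

Lemma rV_not_discrete (K : numFieldType) (m : nat) :
  ~ discrete_space 'rV[K^o]_m.+1.
Proof.
move=> dX; apply: (@numField_not_discrete K).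
apply: (@discrete_inj _ _ (fun t : K^o => const_mx t)) dX.
  by move=> s t /rowP/(_ ord0); rewrite !mxE.
apply: continuous_mx => i j x.
rewrite (_ : (fun _ => _) = id); first exact: cvg_id.
by apply/funext => t; rewrite mxE.
Qed.

End NonDiscrete.

Section ShiftAction.
Variables (K : numFieldType) (m : nat).
Notation X := 'rV[K^o]_m.+1.
Implicit Types (g : K^o) (x y : X).

Definition shift_dir x : X :=
  \row_j (if j == 0 then 1 else x 0 (inord j.-1)).

Definition shift_act g x y : X := y + g *: shift_dir x.

Lemma shift_actE g x y j :
  shift_act g x y 0 j =
  y 0 j + g * (if j == 0 then 1 else x 0 (inord j.-1)).
Proof. by rewrite !mxE. Qed.

Lemma shift_act_binary : binary_action shift_act.
Proof.
split=> [|g h x y|x y].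
- apply: continuous_mx => i j p; rewrite (ord1 i).
  rewrite (_ : (fun _ => _) = fun q : K^o * X * X =>
      q.2 0 j + q.1.1 * (if j == 0 then 1 else q.1.2 0 (inord j.-1))); last first.
    by apply/funext => q; rewrite shift_actE.
  have coord k : continuous (fun z : X => z 0 k) by exact: coord_continuous.
  apply: cvgD.
    by apply: (@continuous_comp _ _ _ snd (fun z : X => z 0 j));
      [exact: cvg_snd|exact: coord].
  apply: cvgM.
    by apply: (@continuous_comp _ _ _ fst fst); exact: cvg_fst.
  case: eqP => _; first exact: cvg_cst.
  apply: (@continuous_comp _ _ _ (fun q : K^o * X * X => q.1.2)
    (fun z : X => z 0 (inord j.-1))); last exact: coord.
  by apply: (@continuous_comp _ _ _ fst snd); [exact: cvg_fst|exact: cvg_snd].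
- by rewrite /shift_act scalerDl addrA addrAC.
- by rewrite /shift_act scale0r addr0.
Qed.

Definition flag (k : nat) : set X :=
  [set x | forall j : 'I_m.+1, (k <= j)%N -> x 0 j = 0].

Lemma flag0 : flag 0 = [set 0].
Proof.
apply/seteqP; split => [x x0|_ -> j _]; last by rewrite mxE.
by apply/rowP => j; rewrite x0 // mxE.
Qed.

Lemma flagT : flag m.+1 = [set: X].
Proof. by apply/seteqP; split => // x _ j; rewrite leqNgt ltn_ord. Qed.

Lemma flag_neqT (k : nat) : (k <= m)%N -> flag k <> [set: X].
Proof.
move=> km flagE; have : flag k (const_mx 1) by rewrite flagE.
by move=> /(_ ord_max km)/eqP; rewrite mxE oner_eq0.
Qed.

(** A shifted vector leaves its stage of the flag by one coordinate at most,
    which bounds the left-hand side; it fills flag k.+1 because one direction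
    transverse to flag k, taken at every point of flag k, already does. *)
Lemma act_set_flag (k : nat) : (k <= m)%N ->
  act_set shift_act (flag k) = flag k.+1.
Proof.
move=> km; apply/seteqP; split => [_ [g [b [a [bk ak ->]]]] j kj|y yk].
  have j0 : j != 0 by rewrite -val_eqE -lt0n (leq_ltn_trans _ kj).
  rewrite shift_actE (negbTE j0) ak ?(ltnW kj)// bk ?mulr0 ?addr0//.
  rewrite inordK; first by rewrite -ltnS prednK// (leq_ltn_trans _ kj).
  by rewrite (leq_ltn_trans (leq_pred _)).
pose g : K^o := y 0 (inord k).
(* The shift turns the basis vector of index k - 1 into that of index k.  For
   k = 0 this b is 0, and the constant first entry of shift_dir serves. *)
pose b : X := \row_j (j.+1 == k)%:R.
have dirE (j : 'I_m.+1) : (k <= j)%N -> shift_dir b 0 j = (j == k :> nat)%:R.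
  move=> kj; rewrite mxE; have [j0|] := eqVneq j 0.
    by move: kj; rewrite j0 leqn0 eq_sym => ->.
  rewrite -val_eqE -lt0n => j0.
  by rewrite mxE inordK ?prednK// ltnW.
exists g, b, (y - g *: shift_dir b); split; last by rewrite /shift_act subrK.
- by move=> j kj; rewrite mxE gtn_eqF// ltnS.
- move=> j kj; have -> : (y - g *: shift_dir b) 0 j = y 0 j - g * shift_dir b 0 j.
    by rewrite [LHS]mxE [X in _ + X]mxE [X in _ - X]mxE.
  rewrite dirE//; have [jk|jk] := eqVneq (j : nat) k.
    by rewrite /g -jk inord_val mulr1 subrr.
  by rewrite mulr0 subr0 yk// ltn_neqAle eq_sym jk.
Qed.

Lemma iter_act_flag (k : nat) : (k <= m.+1)%N ->
  iter k (act_set shift_act) [set 0] = flag k.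
Proof.
elim: k => [|k IHk] km; first by rewrite flag0.
by rewrite iterS IHk ?act_set_flag// ltnW.
Qed.

Lemma shift_act_homogeneous : homogeneous shift_act.
Proof.
exists 0; apply/seteqP; split=> // x _.
by apply: (@act_iter_sub_orbit _ _ _ m.+1); rewrite iter_act_flag// flagT.
Qed.

Lemma shift_act_stabilizes : stabilizes_at shift_act m.+1 0.
Proof.
split=> [|m_gt0]; first by rewrite act_iterE// iter_act_flag// flagT.
by rewrite act_iterE// iter_act_flag//; exact: flag_neqT.
Qed.

End ShiftAction.

Theorem theorem4 (n : nat) (n_ge1 : (1 <= n)%N) :
  exists (G : topologicalZmodType) (X : topologicalType)
         (mu : G -> X -> X -> X),
    [/\ ~ discrete_space G,
        ~ discrete_space X,
        binary_action mu,
        homogeneous mu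
      & exists x : X, stabilizes_at mu n x].
Proof.
case: n n_ge1 => // m _.
exists Rdefinitions.R^o, 'rV[Rdefinitions.R^o]_m.+1, (@shift_act Rdefinitions.R m).
split.
- exact: numField_not_discrete.
- exact: rV_not_discrete.
- exact: shift_act_binary.
- exact: shift_act_homogeneous.
- by exists 0; exact: shift_act_stabilizes.
Qed.
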